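(* Let $w\in \mathbf{C}^{\infty}$ have height $k>0$. If $w$ is single-rooted, then $w$ contains exactly one factor that is a single-rooted minimal word of height $k$. If $w$ is double-rooted, then $w$ contains exactly two factors $u\neq u'$ that are single-rooted minimal words of height $k$.
   Context: Let $\Sigma=\{1,2\}$. A factor of a word $w$ is a word $v$ with $w=xvy$ for some words $x,y$. For a word $w$ over $\Sigma$ written uniquely as $w=x_1^{i_1}\cdots x_n^{i_n}$ with $x_j\in\Sigma$, $x_j\neq x_{j+1}$, $i_j>0$, its run-length encoding is $\Delta(w)=i_1i_2\cdots i_n$. A word $w$ is differentiable if $\Delta(w)$ is a word over $\Sigma$ (equivalently, $w$ contains neither $111$ nor $222$). The derivative $D(w)$ of a differentiable word is defined by $D(\epsilon)=\epsilon$, and otherwise $D(w)$ is obtained from $\Delta(w)$ by deleting its first symbol if that symbol is $1$ and deleting its last symbol if that symbol is $1$ (so $D(w)=\epsilon$ when $\Delta(w)=1$ or $\Delta(w)=11$). $\mathbf{C}^{\infty}$ is the set of words $w$ over $\Sigma$ for which $D^j(w)$ is defined for every $j\ge 0$ ($D^0(w)=w$). The height of $w\in\mathbf{C}^{\infty}$ is the least $k$ with $D^k(w)=\epsilon$. For $w$ of height $k>0$, its root is $D^{k-1}(w)\in\{1,2,12,21\}$; $w$ is single-rooted if its root has length one and double-rooted if its root has length two. A primitive of a word $w$ is any word $w'$ with $D(w')=w$. A word $w\in\mathbf{C}^{\infty}$ of height $k>1$ is minimal if for every $0\le j\le k-2$, $D^j(w)$ is a primitive of $D^{j+1}(w)$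 of minimal length among all primitives of $D^{j+1}(w)$; all words of height $1$ are considered minimal. *)

(* Defs.v *)
From mathcomp Require Import all_boot.

Set Implicit Arguments.
Unset Strict Implicit.
Unset Printing Implicit Defensive.

(* Letters are the natural numbers 1 and 2, so that a run-length encoding is
   again a sequence of the same type as a word. *)
Definition is_word (w : seq nat) : bool :=
  all (fun x => (x == 1) || (x == 2)) w.

(* Run-length encoding of x^n s, for n > 0. *)
Fixpoint run_lengths (x n : nat) (s : seq nat) : seq nat :=
  match s with
  | [::] => [:: n]
  | y :: s' => if y == x then run_lengths x n.+1 s'
               else n :: run_lengths y 1 s'
  end.

Definition Delta (w : seq nat) : seq nat :=
  match w with
  | [::] => [::]
  | x :: s => run_lengths x 1 s
  end.

Definition differentiable (w : seq nat) : bool :=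
  is_word w && is_word (Delta w).

Definition trim_first (s : seq nat) : seq nat :=
  if s is 1 :: s' then s' else s.

Definition trim_last (s : seq nat) : seq nat := rev (trim_first (rev s)).

(* Total on seq nat; it is the derivative only on differentiable words.  The
   first 1 is deleted before the last one, so Delta w = 1 gives the empty word. *)
Definition D (w : seq nat) : seq nat := trim_last (trim_first (Delta w)).

Definition Cinf (w : seq nat) : Prop := forall j, differentiable (iter j D w).

Lemma size_run_lengths x n s :
  size (run_lengths x n s) <= (size s).+1 /\
  (size (run_lengths x n s) = (size s).+1 -> head 0 (run_lengths x n s) = n).
Proof.
elim: s x n => [|y s IHs] x n //=.
case: ifP => _ /=; last by have [h _] := IHs y 1; split.
have [h _] := IHs x n.+1; split; first exact: leqW.
by move=> E; move: h; rewrite E ltnn.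
Qed.

Lemma size_trim_first s : size (trim_first s) <= size s.
Proof. by case: s => [|[|[|x]] s] //=. Qed.

Lemma size_trim_last s : size (trim_last s) <= size s.
Proof. by rewrite /trim_last size_rev -(size_rev s) size_trim_first. Qed.

Lemma size_D w : w != [::] -> size (D w) < size w.
Proof.
case: w => [//|x s] _; rewrite /D; apply: leq_ltn_trans (size_trim_last _) _.
have [] := size_run_lengths x 1 s; rewrite /Delta.
case: (run_lengths x 1 s) => [//|n t] le_ts heq.
have [E|neq] := eqVneq (size t) (size s).
  by have /= -> := heq (congr1 S E); rewrite /= E.
apply: leq_ltn_trans (size_trim_first _) _.
by rewrite /= ltnS ltn_neqAle neq.
Qed.

Lemma height_ex w : exists k, iter k D w == [::].
Proof.
have [n] := ubnP (size w); elim: n w => [//|n IHn] w; rewrite ltnS => le_wn.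
have [->|w0] := eqVneq w [::]; first by exists 0.
have [k Hk] := IHn (D w) (leq_trans (size_D w0) le_wn).
by exists k.+1; rewrite iterSr.
Qed.

Definition height (w : seq nat) : nat := ex_minn (height_ex w).

Definition root (w : seq nat) : seq nat := iter (height w).-1 D w.

Definition single_rooted (w : seq nat) : bool := size (root w) == 1.
Definition double_rooted (w : seq nat) : bool := size (root w) == 2.

Definition primitive (w w' : seq nat) : Prop := differentiable w' /\ D w' = w.

Definition minimal_primitive (w w' : seq nat) : Prop :=
  primitive w w' /\ forall v, primitive w v -> size w' <= size v.

(* The range of j is empty when the height is 1. *)
Definition minimal_word (w : seq nat) : Prop :=
  [/\ Cinf w, 0 < height w &
      forall j, j.+2 <= height w ->
        minimal_primitive (iter j.+1 D w) (iter j D w)].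

Definition single_rooted_minimal (k : nat) (u : seq nat) : Prop :=
  [/\ minimal_word u, single_rooted u & height u = k].

(* Main.v *)
Require Import Defs.
From mathcomp Require Import all_boot.
From mathcomp Require Import zify.

(* A minimal primitive u of a nonempty word v has Delta u equal to v, with a 1
   added at each end where v itself begins or ends with 1.  When w is
   differentiable, cutting w along its runs puts the occurrences in w of such
   words u in bijection with the occurrences of words v in D w: a truncated run
   at an end of u has length 1 and is deleted by D, and conversely a 1 at an end
   of v is never an end run of w, so that w has a letter to extend by.  The
   induction on the height must therefore count occurrences rather than factors,
   since the two minimal primitives of v are complements of each other and could
   come from two occurrences of the same v; pairwise distinctness of the words
   lifts for free, as D maps them back to distinct words. *)

(** * Run lengths: inversion, concatenation, cubes *)

Definition letter (x : nat) : bool := (x == 1) || (x == 2).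

(** With positive run lengths this inverts [Delta] once the first letter [c] is fixed; [3 - c]
    exchanges 1 and 2. *)
Fixpoint runs (c : nat) (l : seq nat) : seq nat :=
  if l is i :: l' then nseq i c ++ runs (3 - c) l' else [::].

(** Letter of the run lying [n] runs after a run of [c]. *)
Definition flip (n c : nat) : nat := iter n (subn 3) c.

Lemma letter_sub c : letter c -> letter (3 - c).
Proof. by case/orP=> /eqP ->. Qed.

Lemma letter_flip n c : letter c -> letter (flip n c).
Proof. by move=> lc; elim: n => //= n; exact: letter_sub. Qed.

Lemma letter_subK c : letter c -> 3 - (3 - c) = c.
Proof. by case/orP=> /eqP ->. Qed.

Lemma neq_letter c d : letter c -> letter d -> c != d -> d = 3 - c.
Proof. by case/orP=> /eqP ->; case/orP=> /eqP ->. Qed.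

Lemma letter_neq_sub c : letter c -> (3 - c == c) = false.
Proof. by case/orP=> /eqP ->. Qed.

Lemma runs_cat c l1 l2 :
  runs c (l1 ++ l2) = runs c l1 ++ runs (flip (size l1) c) l2.
Proof.
elim: l1 c => //= i l1 IHl c; rewrite IHl catA; congr (_ ++ runs _ _).
exact: (esym (iterSr _ _ _)).
Qed.

Lemma is_word_cat u v : is_word (u ++ v) = is_word u && is_word v.
Proof. exact: all_cat. Qed.

Lemma runs_is_word c l : letter c -> is_word (runs c l).
Proof.
elim: l c => //= i l IHl c lc; rewrite is_word_cat IHl ?letter_sub // andbT.
by rewrite /is_word all_nseq -/(letter c) lc orbT.
Qed.

Lemma size_runs c l : size (runs c l) = sumn l.
Proof. by elim: l c => //= i l IHl c; rewrite size_cat size_nseq IHl. Qed.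

(** The accumulator [n] and the pending copies [m] are general for the induction; positivity keeps
    neighbouring runs from merging. *)
Lemma run_lengths_runs c n m l : letter c -> all (leq 1) l ->
  run_lengths c n (nseq m c ++ runs (3 - c) l) = (n + m) :: l.
Proof.
elim: l c n m => [|i l IHl] c n m lc.
  by move=> _; elim: m n => /= [|m IHm] n; rewrite ?addn0 // eqxx IHm addSnnS.
case/andP=> i_gt0 l_gt0.
elim: m n => [|m IHm] n; last by rewrite /= eqxx IHm addSnnS.
case: i i_gt0 => // i _; rewrite /= letter_neq_sub //.
by rewrite IHl ?letter_sub // add1n addn0.
Qed.

Lemma DeltaK_runs c l : letter c -> all (leq 1) l -> Delta (runs c l) = l.
Proof.
by case: l => [//|[//|i] l] lc /=; apply: (@run_lengths_runs _ _ i).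
Qed.

Lemma runs_run_lengths x n s : is_word (x :: s) ->
  runs x (run_lengths x n s) = nseq n x ++ s.
Proof.
elim: s x n => [|y s IHs] x n /=; first by rewrite !cats0.
case/and3P=> lx ly ws; case: eqVneq => [->|neq_yx].
  rewrite IHs; last by rewrite /= lx.
  by rewrite -[n.+1]addn1 nseqD -catA.
rewrite /= -(neq_letter x y) 1?eq_sym // IHs //.
by rewrite /= ly.
Qed.

Lemma runs_Delta w : is_word w -> runs (head 1 w) (Delta w) = w.
Proof. by case: w => [//|x s] ws /=; rewrite runs_run_lengths. Qed.

Lemma letter_head w : is_word w -> letter (head 1 w).
Proof. by case: w => [//|x s] /andP[]. Qed.

Lemma run_lengths_gt0 x n s : 0 < n -> all (leq 1) (run_lengths x n s).
Proof.
by elim: s x n => [|y s IHs] x n n0 /=; [|case: ifP => _ /=]; rewrite ?n0 ?IHs.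
Qed.

Lemma Delta_gt0 w : all (leq 1) (Delta w).
Proof. by case: w => [//|x s]; apply: run_lengths_gt0. Qed.

Lemma sumn_run_lengths x n s : sumn (run_lengths x n s) = n + size s.
Proof.
by elim: s x n => [|y s IHs] x n //=; case: ifP => _ /=; rewrite IHs ?addSnnS.
Qed.

Lemma sumn_Delta w : sumn (Delta w) = size w.
Proof. by case: w => [//|x s]; rewrite /= sumn_run_lengths. Qed.

Lemma Delta_eq0 w : (Delta w == [::]) = (w == [::]).
Proof.
case: w => [//|x s]; apply/eqP => /(congr1 sumn).
by rewrite sumn_Delta.
Qed.

(* The default 3 is not a letter, so the condition holds when v is empty. *)
Lemma run_lengths_cat x n s v : last x s != head 3 v ->
  run_lengths x n (s ++ v) = run_lengths x n s ++ Delta v.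
Proof.
elim: s x n => [|z s IHs] x n /=.
  by case: v => [//|y v] /=; rewrite eq_sym => /negbTE ->.
by case: (z =P x) => [->|_] h; rewrite IHs.
Qed.

Lemma Delta_cat u v : last 0 u != head 3 v -> Delta (u ++ v) = Delta u ++ Delta v.
Proof. by case: u => [//|x s] h; exact: (run_lengths_cat x 1 s v h). Qed.

Lemma is_word_run_lengths_le x n s : is_word (run_lengths x n s) -> n <= 2.
Proof.
elim: s x n => [|y s IHs] x n /=; first by case/andP=> /orP[]/eqP->.
by case: ifP => _ /=; [move/IHs/ltnW | case/andP=> /orP[]/eqP->].
Qed.

(** The three letters lie in one run, whose length then exceeds 2. *)
Lemma no_cube u c v : is_word (Delta (u ++ [:: c; c; c] ++ v)) = false.
Proof.
apply/negP.
case: u => [|x s] /=; first by rewrite !eqxx => /is_word_run_lengths_le.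
elim: s x (1) => [|y s IHs] x n /=; last first.
  by case: ifP => _ /=; [|case/andP=> _]; apply: IHs.
rewrite !eqxx; case: ifP => [/eqP ->|_] /=.
  by rewrite !eqxx => /is_word_run_lengths_le; lia.
by case/andP=> _ /is_word_run_lengths_le.
Qed.

(** * Trimming and its least inverse *)

(** Least run-length word that trims to a nonempty [v]: where [v] has a 1 at an end, a further 1
    must be there to be deleted in its place. *)
Definition ext (v : seq nat) : seq nat :=
  nseq (head 0 v == 1) 1 ++ v ++ nseq (last 0 v == 1) 1.

Definition trim (t : seq nat) : seq nat := trim_last (trim_first t).

Lemma trim_firstE t : t = nseq (head 0 t == 1) 1 ++ trim_first t.
Proof. by case: t => [|[|[|n]] t]. Qed.

Lemma trim_lastE t : t = trim_last t ++ nseq (last 0 t == 1) 1.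
Proof.
case/lastP: t => [//|s x]; rewrite /trim_last rev_rcons last_rcons.
case: eqVneq => [->|]; first by rewrite /= revK cats1.
by case: x => [|[|x]] //= _; rewrite rev_cons revK cats0.
Qed.

Lemma trimE t : trim t != [::] ->
  t = nseq (head 0 t == 1) 1 ++ trim t ++ nseq (last 0 t == 1) 1.
Proof.
rewrite {1}/trim => t0; rewrite {1}[t]trim_firstE; congr (_ ++ _).
(* Something survives trimming, so [trim_first t] is nonempty and keeps the last letter of [t]. *)
have -> : last 0 t = last 0 (trim_first t); last exact: trim_lastE.
case: (trim_first t) (trim_firstE t) t0 => [//|a s] -> _.
by rewrite last_cat.
Qed.

(** With [t] empty, a leading 1 of [v] would itself be deleted. *)
Lemma trim_first_cat t v : v != [::] -> (head 0 v == 1 -> t != [::]) ->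
  trim_first (t ++ v) = trim_first t ++ v.
Proof.
case: t => [|[|[|x]] t] //=.
by case: v => [//|[|[|x]] v] //= _ /(_ isT).
Qed.

Lemma head_rev (x : nat) s : head x (rev s) = last x s.
Proof. by case/lastP: s => [//|s y]; rewrite rev_rcons last_rcons. Qed.

Lemma rev_eq0 (s : seq nat) : (rev s == [::]) = (s == [::]).
Proof. by rewrite -!size_eq0 size_rev. Qed.

Lemma trim_last_cat t v : v != [::] -> (last 0 v == 1 -> t != [::]) ->
  trim_last (v ++ t) = v ++ trim_last t.
Proof.
move=> v0 vt; rewrite /trim_last rev_cat trim_first_cat ?rev_eq0 //.
  by rewrite rev_cat revK.
by rewrite head_rev.
Qed.

Lemma trim_cat t1 v t2 : v != [::] -> (head 0 v == 1 -> t1 != [::]) ->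
  (last 0 v == 1 -> t2 != [::]) ->
  trim (t1 ++ v ++ t2) = trim_first t1 ++ v ++ trim_last t2.
Proof.
case: v => [//|a v] _ h1 h2.
by rewrite /trim trim_first_cat // catA trim_last_cat ?last_cat //
  -?catA // -size_eq0 size_cat addnS.
Qed.

Lemma trim_ext v : v != [::] -> trim (ext v) = v.
Proof.
move=> v0; rewrite trim_cat //; [|by move=> -> ..].
by case: (_ == 1); case: (_ == 1); rewrite /= ?cats0.
Qed.

Lemma runs_nseq1 (b : bool) c : runs c (nseq b 1) = nseq b c.
Proof. by case: b. Qed.

Lemma runs_rcons c l i :
  runs c (rcons l i) = runs c l ++ nseq i (flip (size l) c).
Proof. by rewrite -cats1 runs_cat /= cats0. Qed.

Lemma runs_last c l : letter c -> all (leq 1) l -> l != [::] ->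
  exists s, runs c l = rcons s (3 - flip (size l) c).
Proof.
case/lastP: l => [//|l i] lc; rewrite all_rcons => /andP[i0 _] _.
exists (runs c l ++ nseq i.-1 (flip (size l) c)).
rewrite runs_rcons size_rcons /= letter_subK ?letter_flip // -cats1 -catA.
by rewrite -[in LHS](prednK i0) -addn1 nseqD.
Qed.

Lemma runs_head_double c v : is_word v -> v != [::] -> head 0 v != 1 ->
  exists s, runs c v = [:: c; c] ++ s.
Proof.
case: v => [//|i v] /andP[/orP[]/eqP-> _] //= _ _.
by exists (runs (3 - c) v).
Qed.

Lemma runs_last_double c v : letter c -> is_word v -> v != [::] ->
  last 0 v != 1 ->
  exists s, runs c v = s ++ nseq 2 (3 - flip (size v) c).
Proof.
move=> lc; case/lastP: v => [//|v i]; rewrite last_rcons /is_word all_rcons.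
case/andP=> /orP[]/eqP-> //= _ _ _; exists (runs c v).
by rewrite runs_rcons size_rcons /= letter_subK ?letter_flip.
Qed.

(** * Factors of a word and of its derivative *)

(** The end letters of [u] that stand for added 1s are handed to the context, leaving complete runs
    of [w] that spell [v]. In the equation both sides count the letters of [w] before these runs. *)
Lemma factor_to_D w x u y v : w = x ++ u ++ y -> differentiable w ->
  Delta u = ext v -> is_word v -> v != [::] ->
  exists x' y', D w = x' ++ v ++ y' /\
    (head 0 (Delta w) == 1) + sumn x' = size x + (head 0 v == 1).
Proof.
move=> Ew /andP[ww wDw] Eu wv v0.
have wu : is_word u by move: ww; rewrite Ew !is_word_cat => /and3P[].
have := runs_Delta _ wu; have := letter_head _ wu; move: (head 1 u) => c lc.
set h := head 0 v == 1; set l := last 0 v == 1.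
rewrite Eu /ext -/h -/l !runs_cat !runs_nseq1 size_nseq.
set c' := flip h c; set d := flip (size v) c' => Eru.
have lc' : letter c' by exact: letter_flip.
have v_gt0 : all (leq 1) v by apply: sub_all wv => i /orP[]/eqP->.
set X := x ++ nseq h c; set Y := nseq l d ++ y.
have EwX : w = X ++ runs c' v ++ Y by rewrite Ew -Eru /X /Y !catA.
(* If [v] ends in 1, [Y] starts with the other letter [d]; otherwise [v] ends in 2, and continuing
   that run would create a cube. The default 3 for an empty [Y] is no letter. *)
have EY : last 0 (runs c' v) != head 3 Y.
  have [s Es] := runs_last c' v lc' v_gt0 v0; rewrite Es last_rcons -/d.
  have ld : letter d by exact: letter_flip.
  rewrite /Y /l; case: (eqVneq (last 0 v) 1) => /= [_|l1].
    by rewrite letter_neq_sub.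
  case Ey: y => [|b y'] /=; first by case/orP: (ld) => /eqP ->.
  apply/eqP => eb; have [s' Es'] := runs_last_double c' v lc' wv v0 l1.
  move: wDw; rewrite EwX /Y /l (negbTE l1) Es' -/d eb Ey -catA catA.
  by rewrite (no_cube (X ++ s') b y').
(* The same at the left end, with the default 0 for an empty [X]. *)
have EX : last 0 X != head 3 (runs c' v ++ Y).
  have -> : head 3 (runs c' v ++ Y) = c'.
    by case: (v) v_gt0 v0 => [|[|i] v'].
  rewrite /X /c' /h; case: (eqVneq (head 0 v) 1) => /= [_|h1].
    by rewrite last_cat /= eq_sym letter_neq_sub.
  rewrite cats0; apply/eqP => ec.
  case/lastP Ex: x ec => [|x0 a]; first by case/orP: (lc) => /eqP ->.
  rewrite last_rcons => ea.
  have [s' Es'] := runs_head_double c v wv v0 h1.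
  move: wDw; rewrite EwX /X /c' /h (negbTE h1) /= Es' Ex ea cats0 cat_rcons.
  by rewrite -catA (no_cube x0 c (s' ++ Y)).
have EDw : Delta w = Delta X ++ v ++ Delta Y.
  by rewrite EwX Delta_cat // Delta_cat // DeltaK_runs.
exists (trim_first (Delta X)), (trim_last (Delta Y)).
(* A leading 1 of [v] is shielded from trimming by the first letter of [u], which lies in [X]. *)
have X0 : h -> Delta X != [::].
  by rewrite Delta_eq0 -size_eq0 size_cat size_nseq => ->; rewrite addn1.
split.
  rewrite /D -/(trim _) EDw trim_cat // -/l Delta_eq0 -size_eq0.
  by rewrite size_cat size_nseq => ->.
have -> : size x + h = size X by rewrite size_cat size_nseq.
rewrite -sumn_Delta [in RHS](trim_firstE (Delta X)) sumn_cat sumn_nseq mul1n.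
congr (_ + _); rewrite EDw; case: (Delta X) X0 => //=.
by rewrite /h; case: (v) v0 => //= i v' _; case: (i == 1) => // /(_ isT).
Qed.

(** The letters of [v] are complete runs of [w]; where [v] has a 1 at an end, one letter of the
    neighbouring run completes [u]. *)
Lemma factor_of_D w x' v y' : differentiable w -> D w = x' ++ v ++ y' ->
  v != [::] ->
  exists x u y, [/\ w = x ++ u ++ y, Delta u = ext v &
    size x + (head 0 v == 1) = (head 0 (Delta w) == 1) + sumn x'].
Proof.
case/andP=> ww wDw ED v0.
have D0 : trim (Delta w) != [::].
  rewrite -[trim _]/(D w) ED -size_eq0 !size_cat.
  by move: v0; rewrite -size_eq0; lia.
have := trimE _ D0; rewrite -[trim _]/(D w) ED.
have := Delta_gt0 w; have := runs_Delta _ ww.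
have := letter_head _ ww; move: (head 1 w) => c lc.
move: (Delta w) => t Ew t_gt0.
set a := head 0 t == 1; set b := last 0 t == 1 => Et.
have {}Et : t = (nseq a 1 ++ x') ++ v ++ (y' ++ nseq b 1) by rewrite {1}Et !catA.
(* Were nothing before [v] in [t], its leading 1 would start [t], so that [a] would hold and put a 1
   in front. *)
have ha : head 0 v == 1 -> nseq a 1 ++ x' != [::].
  move=> hv; apply/eqP => a0.
  have : a by move: hv; rewrite /a Et a0; case: (v) v0.
  by move=> aT; rewrite aT in a0.
have hb : last 0 v == 1 -> y' ++ nseq b 1 != [::].
  move=> lv; apply/eqP => b0.
  have : b by move: lv; rewrite /b Et b0 cats0 last_cat; case: (v) v0.
  by move=> bT; rewrite bT cats1 in b0; case: (y') b0.
move: t_gt0 Ew; rewrite {1 2}Et all_cat (all_cat _ v) runs_cat (runs_cat _ v).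
have -> : a + sumn x' = sumn (nseq a 1 ++ x').
  by rewrite sumn_cat sumn_nseq mul1n.
move: {ED Et} (_ ++ x') (y' ++ _) ha hb => t1 t2 ha hb /and3P[p1 pv p2].
set c' := flip _ c; set d := flip _ c' => Ew.
have lc' : letter c' by exact: letter_flip.
have ld : letter d by exact: letter_flip.
set h := head 0 v == 1; set l := last 0 v == 1.
(* If [v] begins with 1, the last letter of the run before it is set aside for [u]. *)
have [x Ex] : exists x, runs c t1 = x ++ nseq h (3 - c').
  rewrite /h; case: (_ == 1) ha => [/(_ isT) t10|_]; last first.
    by exists (runs c t1); rewrite cats0.
  by have [x ->] := runs_last c t1 lc p1 t10; exists x; rewrite cats1.
have [y Ey] : exists y, runs d t2 = nseq l d ++ y.
  rewrite /l; case: (_ == 1) hb => [/(_ isT) t20|_]; last by exists (runs d t2).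
  by case: t2 p2 t20 {Ew} => [//|[//|i] t2] _ _; eexists.
exists x, (nseq h (3 - c') ++ runs c' v ++ nseq l d), y; split.
- by rewrite -Ew Ex Ey !catA.
- have <- : runs (flip h c') (ext v) = nseq h (3 - c') ++ runs c' v ++ nseq l d.
    rewrite /ext -/h -/l !runs_cat !runs_nseq1 size_nseq.
    have -> : flip h (flip h c') = c' by case: (h) => //=; rewrite letter_subK.
    by case: (h).
  rewrite DeltaK_runs ?letter_flip //.
  by rewrite /ext !all_cat pv !all_nseq !orbT.
- by rewrite -(size_runs c) Ex size_cat size_nseq.
Qed.

(** * Height, root and minimal primitives *)

Lemma height0 : height [::] = 0.
Proof.
by rewrite /height; case: ex_minnP => k _ /(_ 0 isT); rewrite leqn0 => /eqP.
Qed.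

Lemma heightS w : w != [::] -> height w = (height (D w)).+1.
Proof.
move=> w0; rewrite /height; case: ex_minnP => k Hk minK.
case: ex_minnP => m Hm minM; apply/eqP; rewrite eqn_leq minK ?iterSr //=.
by case: k Hk {minK} => [/= Ew|k]; [rewrite Ew in w0 | rewrite iterSr => /minM].
Qed.

Lemma height_eq0 w : (height w == 0) = (w == [::]).
Proof. by case: (eqVneq w [::]) => [->|/heightS->] //; rewrite height0. Qed.

Lemma CinfD w : Cinf w <-> differentiable w /\ Cinf (D w).
Proof.
split=> [Cw|[dw CDw] [|j]] //; last by rewrite iterSr; exact: CDw.
by split=> [|j]; [exact: (Cw 0) | rewrite -iterSr; exact: Cw].
Qed.

Lemma rootD w : D w != [::] -> Defs.root w = Defs.root (D w).
Proof.
move=> D0; have w0 : w != [::] by apply: contra_neq D0 => ->.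
by rewrite /Defs.root (heightS w) //= (heightS (D w)) // iterSr.
Qed.

(** The length of a word is the sum of its run lengths, and any [t] that trims to [v] is [v] with
    optional 1s at the ends, of which those in [ext v] are forced. *)
Lemma minimal_primitiveP v u : is_word v -> v != [::] ->
  minimal_primitive v u <-> is_word u /\ Delta u = ext v.
Proof.
move=> wv v0.
have we : is_word (ext v).
  by rewrite /ext !is_word_cat wv /is_word !all_nseq !orbT.
have ext_le t : trim t = v ->
    sumn (ext v) <= sumn t /\ (sumn t <= sumn (ext v) -> t = ext v).
  move=> Et; have := trimE t; rewrite Et => /(_ v0) tE.
  have ha : head 0 v == 1 -> head 0 t == 1.
    by move=> hv; rewrite {1}tE; case: (head 0 t == 1) => //; case: (v) v0 hv.
  have hb : last 0 v == 1 -> last 0 t == 1.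
    move=> lv; rewrite {1}tE; case: (last 0 t == 1).
      by rewrite catA last_cat.
    by rewrite cats0 last_cat; case: (v) v0 lv.
  move: ha hb tE; move: (head 0 t == 1) (last 0 t == 1) => a b + + ->.
  rewrite /ext.
  case: (head 0 v == 1) => [/(_ isT) ->|_];
    case: (last 0 v == 1) => [/(_ isT) ->|_];
    case: a; case: b; rewrite !sumn_cat /=; split=> //; lia.
split=> [[[/andP[wu _] Du] min_u]|[wu Eu]]; last first.
  split.
    by split; [rewrite /differentiable wu Eu | rewrite /D Eu -/(trim _) trim_ext].
  by move=> u' [_ Du']; rewrite -!sumn_Delta Eu; have [] := ext_le _ Du'.
split=> //; apply: (ext_le _ Du).2; rewrite sumn_Delta.
have e_gt0 : all (leq 1) (ext v) by apply: sub_all we => i /orP[]/eqP->.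
(* The primitive [runs 1 (ext v)] attains the bound; its first letter is an arbitrary choice. *)
rewrite -(size_runs 1); apply: min_u; split.
  by rewrite /differentiable runs_is_word // DeltaK_runs.
by rewrite /D DeltaK_runs // -/(trim _) trim_ext.
Qed.

(** Deriving shifts the index of each minimality condition by one; the condition at 0 is left
    over. *)
Lemma single_rooted_minimalS k u :
  single_rooted_minimal k.+2 u <->
  single_rooted_minimal k.+1 (D u) /\ minimal_primitive (D u) u.
Proof.
split=> [[[Cu _ mu] ru hu]|[[[Cu hu mu] ru hDu] pu]].
  have u0 : u != [::] by rewrite -height_eq0 hu.
  have hDu : height (D u) = k.+1 by move: hu; rewrite heightS // => -[].
  have Du0 : D u != [::] by rewrite -height_eq0 hDu.
  split; last by apply: (mu 0); rewrite hu.
  split=> //; last by rewrite /single_rooted -rootD.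
  split; [by have /CinfD[] := Cu | by rewrite hDu|].
  move=> j hj; rewrite -!iterSr; apply: mu.
  by rewrite hu -hDu.
have Du0 : D u != [::] by rewrite -height_eq0 hDu.
have u0 : u != [::] by apply: contra_neq Du0 => ->.
have hSu : height u = k.+2 by rewrite heightS // hDu.
split=> //; last by rewrite /single_rooted rootD.
split; [by apply/CinfD; split=> //; case: pu => -[] | by rewrite hSu|].
by case=> [|j] // hj; rewrite !(iterSr _ D u); apply: mu; rewrite hDu -ltnS -hSu.
Qed.

(** * Lifting occurrences from the derivative *)

(** The prefix [p.1] records the position, keeping equal words at different places apart. *)
Definition occurrence (k : nat) (w : seq nat) (p : seq nat * seq nat) : Prop :=
  single_rooted_minimal k p.2 /\ exists y, w = p.1 ++ p.2 ++ y.

(* A pair (x, v) stands for the occurrence of v in D w just after the prefix x;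
   sums of run lengths turn it into an occurrence in w. *)
Definition lift_factor (w : seq nat) (p : seq nat * seq nat) :
    seq nat * seq nat :=
  let n := (head 0 (Delta w) == 1) + sumn p.1 - (head 0 p.2 == 1) in
  (take n w, take (sumn (ext p.2)) (drop n w)).

Lemma lift_factorE w x' v x u y : w = x ++ u ++ y -> Delta u = ext v ->
  (head 0 (Delta w) == 1) + sumn x' = size x + (head 0 v == 1) ->
  lift_factor w (x', v) = (x, u).
Proof.
move=> Ew Eu En; rewrite /lift_factor /= En addnK -Eu sumn_Delta.
by rewrite Ew take_size_cat // drop_size_cat // take_size_cat.
Qed.

Lemma single_rooted_minimal_word k u :
  single_rooted_minimal k.+1 u -> is_word u /\ u != [::].
Proof.
by case=> -[Cu hu _] _ _; rewrite -height_eq0 -lt0n hu; have /andP[] := Cu 0.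
Qed.

(** Lifting is onto: the position equation of [factor_to_D] makes it recover [p]. *)
Lemma occurrence_D k w p : differentiable w -> occurrence k.+2 w p ->
  exists2 p', occurrence k.+1 (D w) p' & p = lift_factor w p'.
Proof.
case: p => x u dw [/single_rooted_minimalS[su mu] [y Ew]].
have [wv v0] := single_rooted_minimal_word _ _ su.
have [_ Eu] := (minimal_primitiveP _ u wv v0).1 mu.
have [x' [y' [ED En]]] := factor_to_D _ _ _ _ _ Ew dw Eu wv v0.
exists (x', D u); first by split=> //; exists y'.
by rewrite (lift_factorE _ _ _ _ _ _ Ew Eu En).
Qed.

Lemma occurrence_lift k w p : differentiable w -> occurrence k.+1 (D w) p ->
  occurrence k.+2 w (lift_factor w p) /\ D (lift_factor w p).2 = p.2.
Proof.
case: p => x' v dw [] /[swap] -[y'].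
rewrite -[(x', v).2]/v -[(x', v).1]/x' => ED sv.
have [wv v0] := single_rooted_minimal_word _ _ sv.
have [x [u [y [Ew Eu En]]]] := factor_of_D _ _ _ _ dw ED v0.
have -> := lift_factorE _ _ _ _ _ _ Ew Eu (esym En).
have wu : is_word u.
  by case/andP: dw => + _; rewrite Ew !is_word_cat => /and3P[].
have mu : minimal_primitive v u by apply/minimal_primitiveP.
have Du : D u = v by case: mu => -[].
split=> //; split; last by exists y.
by apply/single_rooted_minimalS; rewrite Du.
Qed.

(** * Height one and the induction on the height *)

Lemma single_rooted_minimal1P u :
  single_rooted_minimal 1 u <-> u = [:: 1] \/ u = [:: 2].
Proof.
have h1 v : v != [::] -> D v = [::] -> height v = 1.
  by move=> v0 Dv; rewrite heightS // Dv height0.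
split=> [[[Cu _ _] ru hu]|Hu].
  move: ru (Cu 0); rewrite /single_rooted /Defs.root hu /=.
  by case: u {Cu hu} => [|a []] // _; rewrite /differentiable /= andbT;
    case/andP=> /orP[]/eqP-> _; [left|right].
have {}h1 : height u = 1 by case: Hu => ->; apply: h1.
split=> //; last by rewrite /single_rooted /Defs.root h1; case: Hu => ->.
split; [|by rewrite h1|by rewrite h1].
have E0 j : iter j D [::] = [::] by elim: j => //= j ->.
by case=> [|j]; rewrite ?iterSr; case: Hu => -> //=; rewrite E0.
Qed.

Lemma height1P w : Cinf w -> height w = 1 -> size w = size (Defs.root w) /\
  (w \in [:: [:: 1]; [:: 2]; [:: 1; 2]; [:: 2; 1]]).
Proof.
move=> Cw hw; rewrite /Defs.root hw /=; split=> //.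
have w0 : w != [::] by rewrite -height_eq0 hw.
have D0 : D w = [::] by apply/eqP; rewrite -height_eq0 -eqSS -heightS // hw.
have /andP[ww _] : differentiable w := Cw 0.
(* As [D w] is empty, [Delta w] consists of the at most two deleted 1s. *)
have Et : Delta w = nseq (head 0 (Delta w) == 1) 1 ++
                    nseq (last 0 (trim_first (Delta w)) == 1) 1.
  rewrite {1}[Delta w]trim_firstE {1}[trim_first _]trim_lastE.
  by rewrite -[trim_last _]/(D w) D0.
move: (letter_head _ ww) (runs_Delta _ ww) Et w0; rewrite -Delta_eq0.
move: (head 1 w) (Delta w) => c t lc <-.
by case: (_ == 1); case: (_ == 1) => -> // _; case/orP: lc => /eqP ->.
Qed.

(** While the derivative is nonempty, deriving preserves the root, so the list for [D w] lifts to
    one of the right size. Distinct words let occurrences be counted as factors. *)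
Lemma occurrences w k : Cinf w -> height w = k.+1 ->
  exists L, [/\ size L = size (Defs.root w), uniq (unzip2 L) &
                forall p, occurrence k.+1 w p <-> p \in L].
Proof.
elim: k w => [|k IHk] w Cw hw.
  have [<- w4] := height1P _ Cw hw.
  (* At height 1 the occurrences are the single letters of [w], one at each position. *)
  exists [seq (take i w, [:: nth 0 w i]) | i <- iota 0 (size w)].
  split; first by rewrite size_map size_iota.
    by move: w4; rewrite !inE => /or4P[]/eqP->.
  move=> [x u]; split.
    case=> /single_rooted_minimal1P /= Hu [y Ew]; apply/mapP; exists (size x).
      rewrite mem_iota Ew !size_cat.
      by case: Hu => ->; rewrite /= addnS ltnS leq_addr.
    by rewrite Ew take_size_cat // nth_cat ltnn subnn; case: Hu => ->.
  case/mapP=> i; rewrite mem_iota /= add0n => hi [-> ->]; split => /=.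
    apply/single_rooted_minimal1P; move: w4 hi; rewrite !inE.
    by move=> /or4P[]/eqP->; case: i => [|[|i]] //= _; auto.
  by exists (drop i.+1 w); rewrite /= -drop_nth // cat_take_drop.
have [dw CDw] := (CinfD w).1 Cw.
have w0 : w != [::] by rewrite -height_eq0 hw.
have hDw : height (D w) = k.+1 by move: hw; rewrite heightS // => -[].
have D0 : D w != [::] by rewrite -height_eq0 hDw.
have [L [sL uL HL]] := IHk _ CDw hDw.
exists (map (lift_factor w) L); split.
- by rewrite size_map sL (rootD w).
- apply: (@map_uniq _ _ D); rewrite -!map_comp.
  rewrite (_ : map _ L = unzip2 L) //; apply/eq_in_map => p /HL.
  by case/(occurrence_lift _ _ _ dw).
- move=> p; split.
    by case/(occurrence_D _ _ _ dw) => p' /HL pL ->; apply: map_f.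
  by case/mapP=> p' /HL /(occurrence_lift _ _ _ dw)[] + _ ->.
Qed.

Theorem theorem2 (w : seq nat) (k : nat) (hw : Cinf w) (hk : height w = k)
    (k_gt0 : 0 < k) :
  (single_rooted w ->
     exists! u : seq nat, infix u w /\ single_rooted_minimal k u) /\
  (double_rooted w ->
     exists u u' : seq nat,
       u <> u' /\
       forall v : seq nat,
         (infix v w /\ single_rooted_minimal k v) <-> (v = u \/ v = u')).
Proof.
case: k k_gt0 hk => // k _ hk.
have [L [sL uL HL]] := occurrences _ _ hw hk.
have factorP v : infix v w /\ single_rooted_minimal k.+1 v <-> v \in unzip2 L.
  split=> [[/infixP[x [y Ew]] sv]|/mapP[p /HL [sp [y Ew]] ->]].
    by apply/mapP; exists (x, v) => //; apply/HL; split=> //; exists y.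
  by split=> //; apply/infixP; exists p.1, y.
(* The root size becomes the length of the duplicate-free list of factors, hence 1 or 2. *)
rewrite /single_rooted /double_rooted -sL -(size_map snd) -/(unzip2 L).
move: (unzip2 L) uL factorP => [|u [|u' [|]]] //= uL factorP; split=> // _.
  exists u; split=> [|v /factorP]; first by apply/factorP; rewrite inE.
  by rewrite inE => /eqP.
exists u, u'; split; first by apply/eqP; move: uL; rewrite inE andbT.
move=> v; split=> [/factorP|vu].
  by rewrite !inE => /orP[]/eqP; [left|right].
by apply/factorP; rewrite !inE; case: vu => ->; rewrite eqxx ?orbT.
Qed.
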